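(* Suppose $q$ is a prime power and $a,b,c,d\in\mathbb{F}_{q^2}$. Write $f(X):=aX^{3q} + bX^{2q+1} + cX^{q+2} + d X^3 \in \mathbb{F}_{q^2}[X]$. Then $f(X)$ permutes $\mathbb{F}_{q^2}$ if and only if (the function induced by) $f(X)$ is $\mathbb{F}_q$-linearly equivalent to one of the following: (1) $X^{q+2}$ (as a map on $\mathbb{F}_{q^2}$), where $q\not\equiv 1\pmod 3$; (2) $(X^3,Y^3)$ (as a map on $\mathbb{F}_q\times\mathbb{F}_q$), where $q\not\equiv 1\pmod 3$; (3) $(X^3-eXY^2,Y^3)$ (as a map on $\mathbb{F}_q\times\mathbb{F}_q$) for some nonsquare $e\in\mathbb{F}_q^*$, where $q\equiv 0\pmod 3$.
   Context: If $U$ and $V$ are $\mathbb{F}_q$-vector spaces, a function $f\colon U\to U$ is $\mathbb{F}_q$-linearly equivalent to a function $g\colon V\to V$ if $f=\rho\circ g\circ\eta^{-1}$ for some $\mathbb{F}_q$-vector space isomorphisms $\rho$ and $\eta$ from $V$ to $U$. Here $\mathbb{F}_{q^2}$ and $\mathbb{F}_q\times\mathbb{F}_q$ are viewed as $\mathbb{F}_q$-vector spaces. *)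

(* Defs.v *)
From HB Require Import structures.
From mathcomp Require Import all_boot all_order all_algebra all_field.
Set Implicit Arguments. Unset Strict Implicit. Unset Printing Implicit Defensive.
Import GRing.Theory.
Local Open Scope ring_scope.

Definition Flinear (F : fieldType) (U V : zmodType)
  (sU : F -> U -> U) (sV : F -> V -> V) (h : U -> V) : Prop :=
  (forall x y, h (x + y) = h x + h y) /\ (forall c x, h (sU c x) = sV c (h x)).

(* f : U -> U is F-linearly equivalent to g : V -> V :
   f = rho \o g \o eta^-1 with rho, eta : V -> U F-linear bijections
   (equivalently f \o eta = rho \o g). *)
Definition lin_equiv (F : fieldType) (U V : zmodType)
  (sU : F -> U -> U) (sV : F -> V -> V) (f : U -> U) (g : V -> V) : Prop :=
  exists rho eta : V -> U,
    [/\ Flinear sV sU rho, bijective rho, Flinear sV sU eta, bijective eta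
      & forall v, f (eta v) = rho (g v)].

(* F_{q^2} viewed as an F_q vector space via the embedding iota *)
Definition scaleL (F L : fieldType) (iota : F -> L) (c : F) (x : L) : L :=
  iota c * x.

Definition scaleP (F : fieldType) (c : F) (v : F * F) : F * F :=
  (c * v.1, c * v.2).

Definition fpoly (L : fieldType) (q : nat) (a b c d : L) : {poly L} :=
  a *: 'X^(3 * q) + b *: 'X^(2 * q + 1) + c *: 'X^(q + 2) + d *: 'X^3.

(* Main.v *)
Require Import Defs.
From HB Require Import structures.
From mathcomp Require Import all_boot all_order all_algebra all_field.
From mathcomp Require Import fingroup cyclic ring zify.

(* In an F-basis of L the map f becomes a pair of binary cubic forms over F, homogeneous of degree
   3; if it is bijective then q is not 1 mod 3, so cubing is bijective on F and f permutes the
   projective line.  Moving one rational point and its image to infinity leaves either (X^3, Y^3)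
   or the affine map h(x) = x + (r x + s) / (x^2 - t x + m), whose denominator has no root in F.
   Since h permutes F, the sums of h^k over F equal those of x^k; for k = 1, 2, 3 partial fractions
   over L evaluate them explicitly and leave only two candidates (q = 2 being handled apart).  One
   is r = s = 0, where the two forms share the factor x^2 - t x y + m y^2, a norm from L: this is
   X^(q+2).  In the other one, with D = t^2 - 4m, r = -2D and s = tD: the pencil spanned by the two
   forms contains two cubes of linear forms if q = 2 mod 3, and one if 3 divides q. *)

Set Implicit Arguments.
Unset Strict Implicit.
Import GRing.Theory.
Local Open Scope ring_scope.

Lemma sum_prim_root (R : idomainType) n (z : R) :
  (1 < n)%N -> n.-primitive_root z -> \sum_(i < n) z ^+ i = 0.
Proof.
move=> n_gt1 z_prim; apply/eqP; move/eqP: (subrX1 z n).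
rewrite (prim_expr_order z_prim) subrr eq_sym mulf_eq0 subr_eq0 -[z == 1]/(z ^+ 1 == 1).
by rewrite -(prim_order_dvd z_prim) dvdn1 gtn_eqF.
Qed.

Section FiniteField.
Variable F : finFieldType.
Local Notation q := #|F|.

Lemma expf_card_pred (x : F) : x != 0 -> x ^+ q.-1 = 1.
Proof.
move=> x_neq0; apply: (mulfI x_neq0).
by rewrite mulr1 -exprS (ltn_predK (card_finNzRing_gt1 F)) expf_card.
Qed.

Lemma finField_prim_root : exists z : F, q.-1.-primitive_root z.
Proof.
have q_gt1 : (1 < q)%N := card_finNzRing_gt1 F.
suff /hasP[z _ z_prim] : has q.-1.-primitive_root (enum (predC1 (0 : F))) by exists z.
apply: has_prim_root; rewrite ?enum_uniq -?cardE ?cardC1 //.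
  by rewrite -ltnS (ltn_predK q_gt1).
by apply/allP => x; rewrite mem_enum inE unity_rootE => /expf_card_pred->.
Qed.

Lemma finField_prim_root_dvd n : (n %| q.-1)%N -> exists z : F, n.-primitive_root z.
Proof.
move=> n_dvd; have [z z_prim] := finField_prim_root.
by exists (z ^+ (q.-1 %/ n)); exact: dvdn_prim_root.
Qed.

Lemma expf_coprime_inj n :
  (0 < n)%N -> coprime n q.-1 -> injective (fun x : F => x ^+ n).
Proof.
move=> n_gt0 /eqP co_n x y /= exy; have [u v uE _] := egcdnP q.-1 n_gt0.
have expK (z : F) : (z ^+ n) ^+ u = z.
  rewrite -exprM mulnC uE co_n addn1 exprS mulnC exprM.
  by have [->|/expf_card_pred->] := eqVneq z 0; rewrite ?mul0r // expr1n mulr1.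
by rewrite -(expK x) exy expK.
Qed.

Lemma expf3_inj : (q %% 3 != 1)%N -> injective (fun x : F => x ^+ 3).
Proof.
have q_gt1 : (1 < q)%N := card_finNzRing_gt1 F.
by move=> q_mod3; apply: expf_coprime_inj => //; rewrite prime_coprime //; lia.
Qed.

Lemma card_pchar_nat : [pchar F].-nat q.
Proof.
have [p p_prime pF] := finPcharP F.
have -> : q = (p ^ logn p q)%N by exact: (card_pprimeChar pF).
by rewrite pnatX pnatE // pF.
Qed.

Lemma natr_card : q%:R = 0 :> F.
Proof.
rewrite -cardsT -FinRing.zmodXgE.
by apply: (@expg_cardG F [set: F]%G); rewrite inE.
Qed.

Lemma natr_prime_eq0 p : prime p -> (p%:R == 0 :> F) = (p %| q)%N.
Proof.
move=> p_prime; apply/idP/idP => [p_eq0|p_dvd].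
  have pF : p \in [pchar F] by rewrite inE p_prime.
  by rewrite (dvdn_pcharf pF) natr_card.
have /andP[_ //] : p \in [pchar F].
have q_gt1 : (1 < q)%N := card_finNzRing_gt1 F.
by apply: (pnatPpi card_pchar_nat); rewrite mem_primes p_prime p_dvd ltnW.
Qed.

Lemma sum_expf k : (k < q.-1)%N -> \sum_(x : F) x ^+ k = 0.
Proof.
case: k => [_|k k_lt]; first by rewrite sumr_const natr_card.
have [z z_prim] := finField_prim_root.
have z_neq0 : z != 0 by rewrite (prim_root_eq0 z_prim) -lt0n (leq_ltn_trans _ k_lt).
have /eqP : \sum_(x : F) x ^+ k.+1 = z ^+ k.+1 * \sum_(x : F) x ^+ k.+1.
  rewrite {1}(reindex_inj (mulfI z_neq0)) mulr_sumr.
  by apply: eq_bigr => x _; rewrite exprMn.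
rewrite -subr_eq0 -{1}[\sum_x _]mul1r -mulrBl mulf_eq0 subr_eq0 eq_sym.
by rewrite -(prim_order_dvd z_prim) gtnNdvd // => /eqP.
Qed.

Lemma sum_expf_card_pred : \sum_(x : F) x ^+ q.-1 = -1.
Proof.
have q_gt1 : (1 < q)%N := card_finNzRing_gt1 F.
have predq_gt0 : (0 < q.-1)%N by lia.
rewrite (bigD1 0) //= expr0n gtn_eqF ?add0r //.
rewrite (eq_bigr (fun _ => 1)) => [|x /expf_card_pred //].
by rewrite sumr_const cardC1 -subn1 natrB ?natr_card ?sub0r // ltnW.
Qed.

End FiniteField.

Section FrobeniusOverFiniteField.
Variables (F : finFieldType) (K : fieldType) (iota : {rmorphism F -> K}).
Local Notation q := #|F|.

Lemma card_pchar_nat_ext : [pchar K].-nat q.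
Proof. by rewrite (eq_pnat _ (fmorph_pchar iota)) card_pchar_nat. Qed.

Lemma exprD_card (x y : K) : (x + y) ^+ q = x ^+ q + y ^+ q.
Proof. exact: exprDn_pchar card_pchar_nat_ext. Qed.

Lemma exprN_card (x : K) : (- x) ^+ q = - x ^+ q.
Proof. exact: exprNn_pchar card_pchar_nat_ext. Qed.

Lemma exprB_card (x y : K) : (x - y) ^+ q = x ^+ q - y ^+ q.
Proof. by rewrite exprD_card exprN_card. Qed.

Lemma rmorph_expf_card (x : F) : iota x ^+ q = iota x.
Proof. by rewrite -rmorphXn expf_card. Qed.

Lemma expf_card_fixedP (z : K) : reflect (exists x, z = iota x) (z ^+ q == z).
Proof.
apply: (iffP eqP) => [z_fixed|[x ->]]; last exact: rmorph_expf_card.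
have : root (map_poly iota ('X^q - 'X)) z.
  by rewrite rmorphB /= map_polyXn map_polyX rootE !hornerE z_fixed subrr.
rewrite finField_genPoly rmorph_prod /=.
under eq_bigr do rewrite rmorphB /= map_polyX map_polyC.
rewrite -(big_map iota xpredT (fun a => 'X - a%:P)) root_prod_XsubC.
by case/mapP => x _ ->; exists x.
Qed.

Lemma rmorph_sub_neq0 (z : K) (x : F) : z ^+ q != z -> iota x - z != 0.
Proof.
by move=> /expf_card_fixedP zF; rewrite subr_eq0; apply/eqP => xz; apply: zF; exists x.
Qed.

Lemma sumr_const_card (c : K) : \sum_(x : F) c = 0.
Proof. by rewrite sumr_const -mulr_natr -(rmorph_nat iota) natr_card rmorph0 mulr0. Qed.

Lemma sum_horner_rmorph (p : {poly K}) :
  (size p <= q)%N -> \sum_(x : F) p.[iota x] = - p`_q.-1.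
Proof.
move=> p_size; under eq_bigr do rewrite (horner_coef_wide _ p_size).
have qE := ltn_predK (card_finNzRing_gt1 F).
have sumE k : \sum_(x : F) p`_k * iota x ^+ k = p`_k * iota (\sum_(x : F) x ^+ k).
  by rewrite rmorph_sum mulr_sumr; apply: eq_bigr => x _; rewrite rmorphXn.
rewrite exchange_big /= -(big_mkord xpredT (fun k => \sum_x p`_k * iota x ^+ k)) -qE.
rewrite big_nat_recr //= sumE sum_expf_card_pred rmorphN1 mulrN1.
rewrite big_nat big1 ?add0r // => k k_lt.
by rewrite sumE sum_expf ?rmorph0 ?mulr0.
Qed.

Lemma sum_shift_expf (mu : K) k : (k < q)%N ->
  \sum_(x : F) (iota x - mu) ^+ k = - (k == q.-1)%:R.
Proof.
move=> k_lt; have size_Xk : size (('X - mu%:P) ^+ k) = k.+1 by rewrite size_exp_XsubC.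
transitivity (\sum_(x : F) (('X - mu%:P) ^+ k).[iota x]).
  by apply: eq_bigr => x _; rewrite !hornerE.
rewrite sum_horner_rmorph ?size_Xk //; congr (- _).
have [->|k_neq] := eqVneq k q.-1; last by rewrite nth_default // size_Xk; lia.
by have /monicP := monic_exp q.-1 (monicXsubC mu); rewrite lead_coefE size_exp_XsubC.
Qed.

(* With y = x - mu one has y ^ q = y - (mu ^ q - mu), so that
   (mu ^ q - mu) / y = 1 - y ^ (q - 1) is a polynomial in x. *)
Lemma sum_inv_expf (mu : K) k : mu ^+ q != mu -> (0 < k <= q)%N ->
  \sum_(x : F) (iota x - mu)^-1 ^+ k = (mu ^+ q - mu)^-1 ^+ k.
Proof.
move=> mu_nfix; set W := mu ^+ q - mu.
have q_gt1 : (1 < q)%N := card_finNzRing_gt1 F.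
have W_neq0 : W != 0 by rewrite subr_eq0.
have inv_recr j x : (j < q)%N -> (iota x - mu)^-1 ^+ j.+1 =
    W^-1 * ((iota x - mu)^-1 ^+ j - (iota x - mu) ^+ (q.-1 - j)).
  move=> j_lt; have y_neq0 := rmorph_sub_neq0 x mu_nfix; set y := iota x - mu in y_neq0 *.
  have y_pred : y ^+ q.-1 = 1 - W / y.
    apply: (mulfI y_neq0); rewrite -exprS (ltn_predK q_gt1) mulrBr mulrCA divff // !mulr1.
    by rewrite exprB_card rmorph_expf_card /W /y; ring.
  rewrite -[y ^+ _](mulfK (expf_neq0 j y_neq0)) -exprD subnK; last by lia.
  by rewrite y_pred exprS exprVn; field; rewrite W_neq0 y_neq0 expf_neq0.
elim: k => [//|[|k] IHk] /andP[_ k_le].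
  under eq_bigr do rewrite inv_recr ?subn0 //.
  rewrite -mulr_sumr sumrB sum_shift_expf ?eqxx; last by lia.
  by rewrite sumr_const_card sub0r opprK mulr1.
under eq_bigr do rewrite inv_recr //.
rewrite -mulr_sumr sumrB IHk; last by lia.
rewrite sum_shift_expf; last by lia.
rewrite ltn_eqF; last by rewrite ltn_subrL /= -ltnS (ltn_predK q_gt1).
by rewrite oppr0 subr0 -exprS.
Qed.

Lemma sum_horner_inv (mu : K) (p : {poly K}) : mu ^+ q != mu -> (size p <= q.+1)%N ->
  \sum_(x : F) p.[(iota x - mu)^-1] = p.[(mu ^+ q - mu)^-1] - p`_0.
Proof.
move=> mu_nfix p_size; under eq_bigr do rewrite (horner_coef_wide _ p_size).
rewrite (horner_coef_wide _ p_size) exchange_big /=.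
rewrite !big_ord_recl /= expr0 mulr1 addrAC subrr sumr_const_card !add0r.
by apply: eq_bigr => k _; rewrite -mulr_sumr sum_inv_expf //= ltn_ord.
Qed.

End FrobeniusOverFiniteField.

Section ConjugatePoles.
Variables (F : finFieldType) (K : fieldType) (iota : {rmorphism F -> K}).
Local Notation q := #|F|.
Variables nu mu : K.
Hypotheses (nu_card : nu ^+ q = mu) (mu_card : mu ^+ q = nu) (mu_neq_nu : mu != nu).

Let q_gt1 : (1 < q)%N := card_finNzRing_gt1 F.

Let mu_nu_neq0 : mu - nu != 0.
Proof. by rewrite subr_eq0. Qed.

Let nu_mu_neq0 : nu - mu != 0.
Proof. by rewrite subr_eq0 eq_sym. Qed.

Let nu_nfix : nu ^+ q != nu.
Proof. by rewrite nu_card. Qed.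

Let mu_nfix : mu ^+ q != mu.
Proof. by rewrite mu_card eq_sym. Qed.

Lemma sum_partial_fractions (p a b : {poly K}) :
    (size p < q)%N -> (size a <= q.+1)%N -> (size b <= q.+1)%N ->
  \sum_(x : F) (p.[iota x] + a.[(iota x - nu)^-1] + b.[(iota x - mu)^-1])
    = (a.[(mu - nu)^-1] - a`_0) + (b.[(nu - mu)^-1] - b`_0).
Proof.
move=> p_size a_size b_size; have qE := ltn_predK q_gt1.
rewrite !big_split /= sum_horner_rmorph ?(ltnW p_size) // nth_default; last by rewrite -ltnS qE.
by rewrite oppr0 add0r !sum_horner_inv // nu_card mu_card.
Qed.

Definition two_pole_fun (rho rho' : K) (x : F) : K :=
  iota x + rho / (iota x - nu) + rho' / (iota x - mu).

Lemma sum_two_pole_fun rho rho' :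
  \sum_(x : F) (two_pole_fun rho rho' x - iota x) = (rho - rho') / (mu - nu).
Proof.
pose a := Poly [:: 0; rho]; pose b := Poly [:: 0; rho'].
transitivity (\sum_(x : F) ((0 : {poly K}).[iota x]
    + a.[(iota x - nu)^-1] + b.[(iota x - mu)^-1])).
  apply: eq_bigr => x _; rewrite /two_pole_fun horner0 !horner_Poly /=; field.
  by rewrite !(rmorph_sub_neq0 iota).
rewrite sum_partial_fractions ?size_poly0 ?(ltnW q_gt1) ?(leq_trans (size_Poly _)) ?leqW //.
by rewrite !horner_Poly !coef_Poly /=; field; rewrite mu_nu_neq0 nu_mu_neq0.
Qed.

Lemma sum_two_pole_fun_sqr rho :
  \sum_(x : F) (two_pole_fun rho rho x ^+ 2 - iota x ^+ 2)
    = - 2%:R * (rho * (rho + (mu - nu) ^+ 2)) / (mu - nu) ^+ 2.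
Proof.
pose c := 2%:R * rho ^+ 2 / (nu - mu).
pose p := Poly [:: 4%:R * rho].
pose a := Poly [:: 0; 2%:R * rho * nu + c; rho ^+ 2].
pose b := Poly [:: 0; 2%:R * rho * mu - c; rho ^+ 2].
transitivity (\sum_(x : F) (p.[iota x] + a.[(iota x - nu)^-1] + b.[(iota x - mu)^-1])).
  apply: eq_bigr => x _; rewrite /two_pole_fun !horner_Poly /= /c; field.
  by rewrite !(rmorph_sub_neq0 iota) ?nu_mu_neq0.
rewrite sum_partial_fractions ?(leq_ltn_trans (size_Poly _)) ?(leq_trans (size_Poly _)) //.
by rewrite !horner_Poly !coef_Poly /= /c; field; rewrite mu_nu_neq0 nu_mu_neq0.
Qed.

Lemma sum_two_pole_fun_cube rho : (2 < q)%N ->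
  \sum_(x : F) (two_pole_fun rho rho x ^+ 3 - iota x ^+ 3)
    = - 3%:R * (nu + mu) * (rho * (rho + (mu - nu) ^+ 2)) / (mu - nu) ^+ 2.
Proof.
move=> q_gt2; pose c := 3%:R * rho ^+ 2 * (1 + 2%:R * nu / (nu - mu)).
pose c' := 3%:R * rho ^+ 2 * (1 - 2%:R * mu / (nu - mu)).
pose p := Poly [:: 3%:R * rho * (nu + mu); 6%:R * rho].
pose a := Poly [:: 0; 3%:R * rho * nu ^+ 2 + c;
                   3%:R * rho ^+ 2 * (nu + rho / (nu - mu)); rho ^+ 3].
pose b := Poly [:: 0; 3%:R * rho * mu ^+ 2 + c';
                   3%:R * rho ^+ 2 * (mu - rho / (nu - mu)); rho ^+ 3].
transitivity (\sum_(x : F) (p.[iota x] + a.[(iota x - nu)^-1] + b.[(iota x - mu)^-1])).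
  apply: eq_bigr => x _; rewrite /two_pole_fun !horner_Poly /= /c /c'; field.
  by rewrite !(rmorph_sub_neq0 iota) ?nu_mu_neq0.
rewrite sum_partial_fractions ?(leq_ltn_trans (size_Poly _)) ?(leq_trans (size_Poly _)) //.
by rewrite !horner_Poly !coef_Poly /= /c /c'; field; rewrite mu_nu_neq0 nu_mu_neq0.
Qed.

(* In characteristic 2 the sum of the squares vanishes identically, and the sum of the cubes takes
   over: there nu + mu = mu - nu is invertible. *)
Lemma inj_two_pole_fun (h : F -> F) rho rho' :
    (2 < q)%N -> injective h -> (forall x, iota (h x) = two_pole_fun rho rho' x) ->
  rho' = rho /\ (rho = 0 \/ rho = - (mu - nu) ^+ 2).
Proof.
move=> q_gt2 h_inj hE.
have sum_h_eq0 k : \sum_(x : F) (two_pole_fun rho rho' x ^+ k - iota x ^+ k) = 0.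
  rewrite sumrB [X in _ - X](reindex_inj h_inj) /= -sumrB big1 // => x _.
  by rewrite hE subrr.
have rhoE : rho' = rho.
  have /eqP : (rho - rho') / (mu - nu) = 0.
    by rewrite -sum_two_pole_fun -[RHS](sum_h_eq0 1%N).
  by rewrite mulf_eq0 invr_eq0 (negPf mu_nu_neq0) orbF subr_eq0 => /eqP.
subst rho'; split=> //.
suff /eqP : rho * (rho + (mu - nu) ^+ 2) = 0.
  by rewrite mulf_eq0 addr_eq0 => /orP[]/eqP; [left | right].
have numerator_eq0 c z : c != 0 -> - c * z / (mu - nu) ^+ 2 = 0 -> z = 0.
  move=> c_neq0 /eqP; rewrite !mulf_eq0 oppr_eq0 invr_eq0 expf_eq0.
  by rewrite (negPf c_neq0) (negPf mu_nu_neq0) orbF => /eqP.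
have [two_eq0|two_neq0] := eqVneq (2%:R : K) 0.
  apply: (@numerator_eq0 (mu - nu)) => //.
  rewrite -[RHS](sum_h_eq0 3%N) sum_two_pole_fun_cube //; congr (_ * _ / _).
  transitivity (- 3%:R * (nu + mu) + 2%:R * (2%:R * nu + mu)); first by ring.
  by rewrite two_eq0 mul0r addr0.
by apply: (numerator_eq0 _ _ two_neq0); rewrite -[RHS](sum_h_eq0 2%N) sum_two_pole_fun_sqr.
Qed.

End ConjugatePoles.

Lemma irreducible_poly_dvd_card (F : finFieldType) (p : {poly F}) :
  irreducible_poly p -> p %| 'X^(#|F| ^ (size p).-1) - 'X.
Proof.
move=> p_irr; have [E dimE [z pz _]] := irredp_FAdjoin p_irr.
apply: contraT; rewrite -(irreducible_poly_coprime _ p_irr) -(coprimep_map (in_alg E)).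
move=> /coprimep_root/(_ pz)/eqP[]; rewrite rmorphB /= map_polyXn map_polyX !hornerE.
by apply/eqP; rewrite subr_eq0 -dimE -(Fermat's_little_theorem {:E}%AS) memvf.
Qed.

Lemma irreducible_poly_root_ext (F L : finFieldType) (iota : {rmorphism F -> L}) (p : {poly F}) :
    #|L| = (#|F| ^ (size p).-1)%N -> irreducible_poly p ->
  exists x : L, root (map_poly iota p) x.
Proof.
move=> cardL p_irr; have := irreducible_poly_dvd_card p_irr.
rewrite -(dvdp_map iota) -cardL rmorphB /= map_polyXn map_polyX finField_genPoly.
case/dvdp_prod_XsubC => mask_roots; case: (mask _ _) => [|x rs] pE.
  have := eqp_size pE; rewrite size_map_poly big_nil size_poly1 => p_size.
  by case: p_irr; rewrite p_size.
by exists x; rewrite (eqp_root pE) root_prod_XsubC mem_head.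
Qed.

Definition anisotropic (F : fieldType) (t m : F) : Prop :=
  forall x, x ^+ 2 - t * x + m != 0.

Definition disc (R : pzRingType) (t m : R) : R := t ^+ 2 - 4%:R * m.

Lemma disc_nonsquare (F : fieldType) (t m : F) :
  2%:R != 0 :> F -> anisotropic t m -> ~ exists y : F, y ^+ 2 = disc t m.
Proof.
move=> two_neq0 tm_anis [y yE]; have /eqP[] := tm_anis ((t + y) / 2%:R).
transitivity ((y ^+ 2 - disc t m) / 4%:R); last by rewrite yE subrr mul0r.
have four_neq0 : 4%:R != 0 :> F by rewrite -[4%N]/(2 * 2)%N natrM mulf_neq0.
by rewrite /disc; field; rewrite ?two_neq0 ?four_neq0.
Qed.

Definition pole_fun (F : fieldType) (t m r s x : F) : F :=
  x + (r * x + s) / (x ^+ 2 - t * x + m).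

Section QuadraticExtension.
Variables (F L : finFieldType) (iota : {rmorphism F -> L}).
Hypothesis cardL : #|L| = (#|F| ^ 2)%N.
Local Notation q := #|F|.

Lemma expf_cardK (x : L) : (x ^+ q) ^+ q = x.
Proof. by rewrite -exprM mulnn -cardL expf_card. Qed.

Lemma anisotropic_conj_roots (t m : F) : anisotropic t m ->
  exists nu : L, [/\ nu ^+ q != nu, iota t = nu + nu ^+ q & iota m = nu * nu ^+ q].
Proof.
move=> tm_anis; pose p : {poly F} := 'X^2 - t *: 'X + m%:P.
have p_size : size p = 3.
  rewrite /p -addrA size_polyDl ?size_polyXn // ltnS (leq_trans (size_polyD _ _)) // geq_max.
  rewrite size_polyN (leq_trans (size_scale_leq _ _)) ?size_polyX //.
  exact: leq_trans (size_polyC_leq1 _) _.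
have p_irr : irreducible_poly p.
  by apply: cubic_irreducible; rewrite ?p_size // => x; rewrite rootE !hornerE.
have [|nu] := irreducible_poly_root_ext iota _ p_irr; first by rewrite p_size.
rewrite rootE rmorphD rmorphB /= map_polyZ map_polyXn map_polyX map_polyC !hornerE => /eqP nu_root.
exists nu; have nu_nfix : nu ^+ q != nu.
  apply/negP => /(expf_card_fixedP iota)[x nuE]; case/negP: (tm_anis x).
  by rewrite -(fmorph_eq0 iota) rmorphD rmorphB rmorphXn rmorphM -nuE nu_root.
have mu_root : (nu ^+ q) ^+ 2 - iota t * nu ^+ q + iota m = 0.
  rewrite -{1}(rmorph_expf_card iota t) -(rmorph_expf_card iota m) -exprMn exprAC.
  rewrite -(exprB_card iota) -(exprD_card iota) nu_root expr0n.
  by rewrite gtn_eqF // ltnW ?card_finNzRing_gt1.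
have tE : iota t = nu + nu ^+ q.
  have /eqP : (nu ^+ q - nu) * (nu + nu ^+ q - iota t) = 0.
    by rewrite -[RHS](subrr 0) -{1}mu_root -nu_root; ring.
  by rewrite mulf_eq0 !subr_eq0 (negPf nu_nfix) /= => /eqP.
by split=> //; rewrite -[RHS]addr0 -nu_root tE; ring.
Qed.

Lemma rmorph_disc (t m : F) (nu mu : L) :
  iota t = nu + mu -> iota m = nu * mu -> iota (disc t m) = (mu - nu) ^+ 2.
Proof.
by move=> tE mE; rewrite /disc rmorphB rmorphXn rmorphM rmorph_nat tE mE; ring.
Qed.

Lemma disc_neq0 (t m : F) : anisotropic t m -> disc t m != 0.
Proof.
move=> /anisotropic_conj_roots[nu [nu_nfix tE mE]].
by rewrite -(fmorph_eq0 iota) (rmorph_disc tE mE) expf_neq0 // subr_eq0.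
Qed.

Lemma inj_pole_fun_card2 (t m r s : F) : q = 2 -> anisotropic t m ->
    injective (pole_fun t m r s) ->
  (r = 0 /\ s = 0) \/ (r = - 2%:R * disc t m /\ s = t * disc t m).
Proof.
move=> q2 tm_anis h_inj.
have two_eq0 : 2%:R = 0 :> F by rewrite -[2%N]q2 natr_card.
have eq1 (x : F) : x != 0 -> x = 1 by move=> /expf_card_pred; rewrite q2.
have m1 : m = 1.
  by apply: eq1; have := tm_anis 0; rewrite expr0n mulr0 subr0 add0r.
have t1 : t = 1.
  apply/eq1; have := tm_anis 1; rewrite m1; apply: contra_neq => ->.
  by rewrite mul0r subr0 expr1n.
have [r0|/eq1 r1] := eqVneq r 0; last first.
  suff /h_inj/eqP : pole_fun t m r s 0 = pole_fun t m r s 1 by rewrite eq_sym oner_eq0.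
  rewrite /pole_fun t1 m1 r1 expr0n expr1n /= !(mulr0, mulr1, subr0, subrr, add0r, divr1).
  by rewrite addrA -mulr2n two_eq0 add0r.
have [s0|/eq1 s1] := eqVneq s 0; [by left | right].
have disc1 : disc t m = 1.
  transitivity (1 - 2%:R * 2%:R : F); first by rewrite /disc t1 m1; ring.
  by rewrite two_eq0 mul0r subr0.
by rewrite disc1 two_eq0 oppr0 mul0r t1 mulr1.
Qed.

Lemma rmorph_pole_fun (t m r s : F) (nu mu : L) (x : F) :
    iota t = nu + mu -> iota m = nu * mu -> nu ^+ q != nu -> mu ^+ q != mu -> mu != nu ->
  iota (pole_fun t m r s x) =
    two_pole_fun iota nu mu ((iota r * nu + iota s) / (nu - mu))
                            ((iota r * mu + iota s) / (mu - nu)) x.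
Proof.
move=> tE mE nu_nfix mu_nfix mu_neq_nu.
have denE : iota (x ^+ 2 - t * x + m) = (iota x - nu) * (iota x - mu).
  by rewrite rmorphD rmorphB rmorphXn rmorphM tE mE; ring.
rewrite /pole_fun /two_pole_fun rmorphD fmorph_div denE rmorphD rmorphM; field.
by rewrite !(rmorph_sub_neq0 iota) //= !subr_eq0 mu_neq_nu eq_sym mu_neq_nu.
Qed.

Lemma inj_pole_fun (t m r s : F) : anisotropic t m -> injective (pole_fun t m r s) ->
  (r = 0 /\ s = 0) \/ (r = - 2%:R * disc t m /\ s = t * disc t m).
Proof.
move=> tm_anis h_inj; have [q_gt2|q_le2] := ltnP 2 q; last first.
  by apply: inj_pole_fun_card2 => //; apply/eqP; rewrite eqn_leq q_le2 card_finNzRing_gt1.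
have [nu [nu_nfix tE mE]] := anisotropic_conj_roots tm_anis.
have muK := expf_cardK nu; set mu := nu ^+ q in nu_nfix tE mE muK.
have mu_nu_neq0 : mu - nu != 0 by rewrite subr_eq0.
have nu_mu_neq0 : nu - mu != 0 by rewrite subr_eq0 eq_sym.
have mu_nfix : mu ^+ q != mu by rewrite muK eq_sym.
have hE x := rmorph_pole_fun r s x tE mE nu_nfix mu_nfix nu_nfix.
have := inj_two_pole_fun (erefl mu) muK nu_nfix q_gt2 h_inj hE.
set rho := (_ / (nu - mu)); set rho' := (_ / (mu - nu)) => -[rho_eq rho_cases].
have rE : iota r = 2%:R * rho.
  transitivity (rho + rho'); last by rewrite rho_eq; ring.
  by rewrite /rho /rho'; field; apply/andP.
have sE : iota s = - iota t * rho.
  transitivity (- rho * mu - rho' * nu); last by rewrite rho_eq tE; ring.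
  by rewrite /rho /rho'; field; apply/andP.
case: rho_cases => rhoE; [left | right]; split; apply: (fmorph_inj iota).
- by rewrite rE rhoE rmorph0 mulr0.
- by rewrite sE rhoE rmorph0 mulr0.
- by rewrite rE rhoE rmorphM rmorphN rmorph_nat (rmorph_disc tE mE); ring.
- by rewrite sE rhoE rmorphM (rmorph_disc tE mE); ring.
Qed.

End QuadraticExtension.

Section LinearEquivalence.
Variable F : fieldType.
Implicit Types U V W : zmodType.

Lemma Flinear_comp U V W (sU : F -> U -> U) (sV : F -> V -> V) (sW : F -> W -> W) g h :
  Flinear sV sW g -> Flinear sU sV h -> Flinear sU sW (g \o h).
Proof. by move=> [gD gZ] [hD hZ]; split=> [x y|k x] /=; rewrite ?hD ?hZ ?gD ?gZ. Qed.

Lemma Flinear_can U V (sU : F -> U -> U) (sV : F -> V -> V) h h' :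
  Flinear sU sV h -> cancel h h' -> cancel h' h -> Flinear sV sU h'.
Proof.
move=> [hD hZ] hK h'K; split=> [x y|k x]; apply: (can_inj hK).
  by rewrite hD !h'K.
by rewrite hZ !h'K.
Qed.

Lemma lin_equiv_trans U V W (sU : F -> U -> U) (sV : F -> V -> V) (sW : F -> W -> W) f g h :
  lin_equiv sU sV f g -> lin_equiv sV sW g h -> lin_equiv sU sW f h.
Proof.
move=> [rho [eta [rhoL rhoB etaL etaB fE]]] [rho' [eta' [rho'L rho'B eta'L eta'B gE]]].
exists (rho \o rho'), (eta \o eta'); split.
- exact: Flinear_comp rhoL rho'L.
- exact: bij_comp.
- exact: Flinear_comp etaL eta'L.
- exact: bij_comp.
- by move=> v /=; rewrite fE gE.
Qed.

Lemma lin_equiv_sym U V (sU : F -> U -> U) (sV : F -> V -> V) f g :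
  lin_equiv sU sV f g -> lin_equiv sV sU g f.
Proof.
move=> [rho [eta [rhoL [rho' rhoK rho'K] etaL [eta' etaK eta'K] fE]]].
exists rho', eta'; split.
- exact: Flinear_can rhoL rhoK rho'K.
- by exists rho.
- exact: Flinear_can etaL etaK eta'K.
- by exists eta.
- by move=> u; apply: (can_inj rhoK); rewrite -fE eta'K rho'K.
Qed.

Lemma lin_equiv_bij U V (sU : F -> U -> U) (sV : F -> V -> V) f g :
  lin_equiv sU sV f g -> bijective g -> bijective f.
Proof.
move=> [rho [eta [_ rhoB _ [eta' etaK eta'K] fE]]] gB.
apply: (@eq_bij _ _ (rho \o g \o eta')).
  by apply: bij_comp; [exact: bij_comp | exists eta].
by move=> u /=; rewrite -fE eta'K.
Qed.

Definition lin2 (a b c d : F) (v : F * F) : F * F :=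
  (a * v.1 + b * v.2, c * v.1 + d * v.2).

Lemma lin2_Flinear a b c d : Flinear (@scaleP F) (@scaleP F) (lin2 a b c d).
Proof. by split=> [[x y] [z w]|k [x y]]; congr (_, _) => /=; ring. Qed.

Lemma lin2_bij a b c d : a * d - b * c != 0 -> bijective (lin2 a b c d).
Proof.
move=> det_neq0; pose det := a * d - b * c.
by exists (lin2 (d / det) (- b / det) (- c / det) (a / det)) => -[x y];
   rewrite /lin2 /det; congr (_, _) => /=; field.
Qed.

Lemma lin_equiv_lin2 (f g : F * F -> F * F) (a b c d a' b' c' d' : F) :
    a * d - b * c != 0 -> a' * d' - b' * c' != 0 ->
    (forall v, f (lin2 a' b' c' d' v) = lin2 a b c d (g v)) ->
  lin_equiv (@scaleP F) (@scaleP F) f g.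
Proof.
move=> rho_det eta_det fE; exists (lin2 a b c d), (lin2 a' b' c' d').
by split=> //; [exact: lin2_Flinear | exact: lin2_bij | exact: lin2_Flinear | exact: lin2_bij].
Qed.

Lemma lin_equiv_lin2_comp (f g : F * F -> F * F) (a b c d : F) :
    a * d - b * c != 0 -> (forall v, f v = lin2 a b c d (g v)) ->
  lin_equiv (@scaleP F) (@scaleP F) f g.
Proof.
move=> det_neq0 fE; apply: (@lin_equiv_lin2 _ _ a b c d 1 0 0 1) => //.
  by rewrite mulr1 mulr0 subr0 oner_neq0.
by move=> [x y]; rewrite -fE /lin2 /= !(mul1r, mul0r, addr0, add0r).
Qed.

End LinearEquivalence.

Section BinaryCubics.
Variable F : fieldType.
Local Notation equivP := (lin_equiv (@scaleP F) (@scaleP F)).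

Definition binary_cubic (p0 p1 p2 p3 : F) (v : F * F) : F :=
  p0 * v.1 ^+ 3 + p1 * v.1 ^+ 2 * v.2 + p2 * v.1 * v.2 ^+ 2 + p3 * v.2 ^+ 3.

Definition cubic_map (c0 c1 c2 c3 v : F * F) : F * F :=
  (binary_cubic c0.1 c1.1 c2.1 c3.1 v, binary_cubic c0.2 c1.2 c2.2 c3.2 v).

Definition cubes (v : F * F) : F * F := (v.1 ^+ 3, v.2 ^+ 3).

Definition quad_form (t m : F) (v : F * F) : F :=
  v.1 ^+ 2 - t * v.1 * v.2 + m * v.2 ^+ 2.

Definition pole_form (t m r s : F) (v : F * F) : F * F :=
  (v.1 * quad_form t m v + (r * v.1 + s * v.2) * v.2 ^+ 2, v.2 * quad_form t m v).

Definition resolvent (t m k : F) : F := k ^+ 2 + t * k + (t ^+ 2 - 3%:R * m).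

Definition exceptional_form (t m : F) : F * F -> F * F :=
  pole_form t m (- 2%:R * disc t m) (t * disc t m).

Definition additive_cubic (e : F) (v : F * F) : F * F :=
  (v.1 ^+ 3 - e * v.1 * v.2 ^+ 2, v.2 ^+ 3).

Lemma cubic_map_scale c0 c1 c2 c3 l v :
  cubic_map c0 c1 c2 c3 (scaleP l v) = scaleP (l ^+ 3) (cubic_map c0 c1 c2 c3 v).
Proof. by rewrite /cubic_map /binary_cubic /scaleP /=; congr (_, _); ring. Qed.

Lemma pole_form_scale t m r s l v :
  pole_form t m r s (scaleP l v) = scaleP (l ^+ 3) (pole_form t m r s v).
Proof. by rewrite /pole_form /quad_form /scaleP /=; congr (_, _); ring. Qed.

Lemma pole_form_affine t m r s x : anisotropic t m ->
  pole_form t m r s (x, 1) = scaleP (x ^+ 2 - t * x + m) (pole_fun t m r s x, 1).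
Proof.
move=> tm_anis; rewrite /pole_form /quad_form /pole_fun /scaleP /=; congr (_, _); last by ring.
by field; exact: tm_anis.
Qed.

Lemma exceptional_form_cube (t m k : F) (v : F * F) : resolvent t m k = 0 ->
  (exceptional_form t m v).1 + (3%:R * k + t) * (exceptional_form t m v).2 = (v.1 + k * v.2) ^+ 3.
Proof.
move=> k_root; apply/esym; transitivity ((v.1 + k * v.2) ^+ 3
    + resolvent t m k * (- 3%:R * v.1 * v.2 ^+ 2 + (t - k) * v.2 ^+ 3)).
  by rewrite k_root mul0r addr0.
by rewrite /resolvent /exceptional_form /pole_form /quad_form /disc /=; ring.
Qed.

Lemma cubic_map_equiv_lead1 c0 c1 c2 c3 : c0 != 0 ->
  exists d1 d2 d3, equivP (cubic_map c0 c1 c2 c3) (cubic_map (1, 0) d1 d2 d3).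
Proof.
move: c0 c1 c2 c3 => [p0 q0] [p1 q1] [p2 q2] [p3 q3] c0_neq0.
have [p0_eq0|p0_neq0] := eqVneq p0 0; last first.
  exists (p1 / p0, q1 - q0 * p1 / p0), (p2 / p0, q2 - q0 * p2 / p0),
    (p3 / p0, q3 - q0 * p3 / p0).
  apply: (@lin_equiv_lin2_comp _ _ _ p0 0 q0 1); first by rewrite mulr1 mul0r subr0.
  by move=> [x y]; rewrite /cubic_map /lin2 /binary_cubic /=; congr (_, _); field.
have q0_neq0 : q0 != 0 by apply: contra_neq c0_neq0 => ->; rewrite p0_eq0.
exists (q1 / q0, p1), (q2 / q0, p2), (q3 / q0, p3).
apply: (@lin_equiv_lin2_comp _ _ _ 0 1 q0 0); first by rewrite mulr0 mul1r sub0r oppr_eq0.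
by move=> [x y]; rewrite /cubic_map /lin2 /binary_cubic /= p0_eq0; congr (_, _); field.
Qed.

Lemma cubic_map_equiv_pole_form (d1 d2 d3 : F * F) : d1.2 != 0 ->
  exists r s, equivP (cubic_map (1, 0) d1 d2 d3)
                     (pole_form (- d2.2 / d1.2) (d3.2 / d1.2) r s).
Proof.
move: d1 d2 d3 => [p1 q1] [p2 q2] [p3 q3] /= q1_neq0; pose k := p1 - q2 / q1.
exists (p2 - q3 / q1 - k * q2 / q1), (p3 - k * q3 / q1).
apply: (@lin_equiv_lin2_comp _ _ _ 1 k 0 q1); first by rewrite mul1r mulr0 subr0.
move=> [x y]; rewrite /cubic_map /lin2 /pole_form /quad_form /binary_cubic /k /=.
by congr (_, _); field.
Qed.

Lemma cubic_map_equiv_totally_ramified p1 p2 p3 q3 : q3 != 0 ->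
  equivP (cubic_map (1, 0) (p1, 0) (p2, 0) (p3, q3)) (cubic_map (1, 0) (p1, 0) (p2, 0) (0, 1)).
Proof.
move=> q3_neq0; apply: (@lin_equiv_lin2_comp _ _ _ 1 p3 0 q3); first by rewrite mul1r mulr0 subr0.
by move=> [x y]; rewrite /cubic_map /lin2 /binary_cubic /=; congr (_, _); ring.
Qed.

Lemma cubic_map_equiv_swap c0 c1 c2 c3 :
  equivP (cubic_map c0 c1 c2 c3)
         (cubic_map (c3.2, c3.1) (c2.2, c2.1) (c1.2, c1.1) (c0.2, c0.1)).
Proof.
have swap_det : 0 * 0 - 1 * 1 != 0 :> F by rewrite mul0r mul1r sub0r oppr_eq0 oner_neq0.
apply: (@lin_equiv_lin2 _ _ _ 0 1 1 0 0 1 1 0) => //.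
by move=> [x y]; rewrite /cubic_map /lin2 /binary_cubic /=; congr (_, _); ring.
Qed.

Definition has_cubic_normal_form (G : F * F -> F * F) : Prop :=
  equivP G cubes \/
  exists t m r s, anisotropic t m /\ equivP G (pole_form t m r s).

Lemma has_cubic_normal_form_equiv G H :
  equivP G H -> has_cubic_normal_form H -> has_cubic_normal_form G.
Proof.
move=> GH [HE|[t [m [r [s [tm_anis HE]]]]]]; first by left; exact: lin_equiv_trans GH HE.
by right; exists t, m, r, s; split=> //; exact: lin_equiv_trans GH HE.
Qed.

End BinaryCubics.

Section BijectiveCubicMaps.
Variable F : finFieldType.
Local Notation q := #|F|.
Local Notation equivP := (lin_equiv (@scaleP F) (@scaleP F)).

Lemma bij_cubic_map_card_mod3 (c0 c1 c2 c3 : F * F) :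
  bijective (cubic_map c0 c1 c2 c3) -> (q %% 3 != 1)%N.
Proof.
move=> /bij_inj G_inj; apply/negP => /eqP q_mod3.
have q_gt1 : (1 < q)%N := card_finNzRing_gt1 F.
have [|w w_prim] := @finField_prim_root_dvd F 3; first by lia.
have /G_inj[] : cubic_map c0 c1 c2 c3 (scaleP w (1, 0)) = cubic_map c0 c1 c2 c3 (1, 0).
  by rewrite cubic_map_scale (prim_expr_order w_prim) /scaleP !mul1r -surjective_pairing.
by rewrite mulr1 => /eqP; rewrite -[w == 1](prim_order_dvd w_prim 1).
Qed.

Lemma expf3_surj (k : F) : (q %% 3 != 1)%N -> exists l : F, l ^+ 3 = k.
Proof. by move=> /expf3_inj/injF_bij[cbrt _ cbrtK]; exists (cbrt k); rewrite cbrtK. Qed.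

(* A root x would give the point (x : 1) the same image (1 : 0) as the point (1 : 0). *)
Lemma bij_cubic_map_no_root (d1 d2 d3 : F * F) : (q %% 3 != 1)%N ->
    bijective (cubic_map (1, 0) d1 d2 d3) ->
  forall x, d1.2 * x ^+ 2 + d2.2 * x + d3.2 != 0.
Proof.
move=> q_mod3 /bij_inj G_inj x; apply/eqP => x_root.
have [l lE] := expf3_surj (binary_cubic 1 d1.1 d2.1 d3.1 (x, 1)) q_mod3.
suff /G_inj[_ /eqP] : cubic_map (1, 0) d1 d2 d3 (x, 1) = cubic_map (1, 0) d1 d2 d3 (l, 0).
  by rewrite oner_eq0.
rewrite /cubic_map -lE; congr (_, _); rewrite /binary_cubic /=; first by ring.
by transitivity (d1.2 * x ^+ 2 + d2.2 * x + d3.2); [ring | rewrite x_root; ring].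
Qed.

(* In the map of the projective line induced by cubic_map (1, 0) d1 d2 d3 the point (1 : 0) is
   fixed; it is unramified iff d1.2 != 0 and totally ramified iff d1.2 = d2.2 = 0. *)
Lemma cubic_normal_form_unramified (d1 d2 d3 : F * F) : (q %% 3 != 1)%N -> d1.2 != 0 ->
  bijective (cubic_map (1, 0) d1 d2 d3) -> has_cubic_normal_form (cubic_map (1, 0) d1 d2 d3).
Proof.
move=> q_mod3 q1_neq0 /(bij_cubic_map_no_root q_mod3) no_root; right.
have [r [s GE]] := cubic_map_equiv_pole_form d2 d3 q1_neq0.
exists (- d2.2 / d1.2), (d3.2 / d1.2), r, s; split=> // x.
by apply: contra_neq (no_root x) => x_root; rewrite -[RHS](mulr0 d1.2) -x_root; field.
Qed.

Lemma cubic_normal_form_totally_ramified (p1 p2 : F) : (q %% 3 != 1)%N ->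
    bijective (cubic_map (1, 0) (p1, 0) (p2, 0) (0, 1)) ->
  has_cubic_normal_form (cubic_map (1, 0) (p1, 0) (p2, 0) (0, 1)).
Proof.
move=> q_mod3 G_bij; have [p2_eq0|p2_neq0] := eqVneq p2 0; last first.
  have swapE := cubic_map_equiv_swap (1, 0) (p1, 0) (p2, 0) (0, 1).
  apply: (has_cubic_normal_form_equiv swapE); apply: cubic_normal_form_unramified => //.
  exact: lin_equiv_bij (lin_equiv_sym swapE) G_bij.
left; have p1_eq0 : p1 = 0.
  suff /(bij_inj G_bij)[/eqP] : cubic_map (1, 0) (p1, 0) (p2, 0) (0, 1) (- p1, 1)
      = cubic_map (1, 0) (p1, 0) (p2, 0) (0, 1) (0, 1) by rewrite oppr_eq0 => /eqP.
  by rewrite /cubic_map /binary_cubic p2_eq0 /=; congr (_, _); ring.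
apply: (@lin_equiv_lin2_comp _ _ _ 1 0 0 1); first by rewrite mulr1 mul0r subr0 oner_neq0.
by move=> [x y]; rewrite /cubic_map /lin2 /binary_cubic p1_eq0 p2_eq0 /=; congr (_, _); ring.
Qed.

Lemma bij_cubic_map_normal_form (c0 c1 c2 c3 : F * F) : (q %% 3 != 1)%N ->
  bijective (cubic_map c0 c1 c2 c3) -> has_cubic_normal_form (cubic_map c0 c1 c2 c3).
Proof.
move=> q_mod3 G_bij.
have c0_neq0 : c0 != 0.
  apply/eqP => c0_eq0; have /(bij_inj G_bij)[/eqP] :
      cubic_map c0 c1 c2 c3 (1, 0) = cubic_map c0 c1 c2 c3 (0, 0).
    by rewrite c0_eq0 /cubic_map /binary_cubic /=; congr (_, _); ring.
  by rewrite oner_eq0.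
have [d1 [d2 [d3 GH]]] := cubic_map_equiv_lead1 c1 c2 c3 c0_neq0.
apply: (has_cubic_normal_form_equiv GH).
have H_bij := lin_equiv_bij (lin_equiv_sym GH) G_bij.
have no_root := bij_cubic_map_no_root q_mod3 H_bij.
have [q1_eq0|q1_neq0] := eqVneq d1.2 0; last exact: cubic_normal_form_unramified.
move: d1 d2 d3 q1_eq0 no_root {GH} H_bij => [p1 q1] [p2 q2] [p3 q3] /= -> no_root H_bij.
have q2_eq0 : q2 = 0.
  by apply/eqP; apply: contraT => q2_neq0; have /eqP[] := no_root (- q3 / q2); field.
have q3_neq0 : q3 != 0 by have := no_root 0; rewrite !(mul0r, mulr0, add0r).
move: H_bij; rewrite q2_eq0 => H_bij.
have ramE := cubic_map_equiv_totally_ramified p1 p2 p3 q3_neq0.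
apply: (has_cubic_normal_form_equiv ramE); apply: cubic_normal_form_totally_ramified => //.
exact: lin_equiv_bij (lin_equiv_sym ramE) H_bij.
Qed.

Lemma inj_pole_form_pole_fun (t m r s : F) : (q %% 3 != 1)%N -> anisotropic t m ->
  injective (pole_form t m r s) -> injective (pole_fun t m r s).
Proof.
move=> q_mod3 tm_anis N_inj x y hxy.
pose den (z : F) := z ^+ 2 - t * z + m.
have [l lE] := expf3_surj (den x / den y) q_mod3.
have /N_inj[-> l1] : pole_form t m r s (x, 1) = pole_form t m r s (scaleP l (y, 1)).
  rewrite pole_form_scale !pole_form_affine // hxy lE /den /scaleP /=.
  by congr (_, _); field; exact: tm_anis.
by rewrite -[l]mulr1 -l1 mul1r.
Qed.

End BijectiveCubicMaps.

Lemma horner_fpoly (L : fieldType) (q : nat) (a b c d x : L) :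
  (fpoly q a b c d).[x]
    = a * (x ^+ q) ^+ 3 + b * (x ^+ q) ^+ 2 * x + c * x ^+ q * x ^+ 2 + d * x ^+ 3.
Proof.
by rewrite /fpoly !(hornerD, hornerZ, hornerXn) (mulnC 3) (mulnC 2) !exprD !exprM expr1 !mulrA.
Qed.

Section QuadraticExtensionCoordinates.
Variables (F L : finFieldType) (iota : {rmorphism F -> L}).
Hypothesis cardL : #|L| = (#|F| ^ 2)%N.
Local Notation q := #|F|.

Definition pair_ext (w : L) (v : F * F) : L := iota v.1 + iota v.2 * w.

Lemma pair_ext_Flinear w : Flinear (@scaleP F) (scaleL iota) (pair_ext w).
Proof.
by split=> [[x y] [z t]|k [x y]]; rewrite /pair_ext /scaleL /= ?rmorphD ?rmorphM /=; ring.
Qed.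

Lemma pair_ext_expf_card w v : pair_ext w v ^+ q = iota v.1 + iota v.2 * w ^+ q.
Proof. by rewrite /pair_ext (exprD_card iota) exprMn !rmorph_expf_card. Qed.

Lemma pair_ext_bij w : w ^+ q != w -> bijective (pair_ext w).
Proof.
move=> w_nfix; apply: inj_card_bij; last by rewrite card_prod cardL mulnn.
move=> u v uv; have uv_conj := congr1 (fun z => z ^+ q) uv.
rewrite /= !pair_ext_expf_card in uv_conj.
have /eqP : iota (u.2 - v.2) * (w ^+ q - w) = 0.
  transitivity ((iota u.1 + iota u.2 * w ^+ q) - (iota v.1 + iota v.2 * w ^+ q)
    - (pair_ext w u - pair_ext w v)); first by rewrite rmorphB /pair_ext; ring.
  by rewrite uv_conj uv !subrr.
rewrite mulf_eq0 (subr_eq0 _ w) (negPf w_nfix) orbF fmorph_eq0 subr_eq0 => /eqP uv2.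
move: uv; rewrite /pair_ext uv2 => /addIr/fmorph_inj uv1.
by rewrite [u]surjective_pairing [v]surjective_pairing uv1 uv2.
Qed.

Lemma fpoly_equiv_cubic_map (a b c d : L) :
  exists c0 c1 c2 c3 : F * F,
    lin_equiv (scaleL iota) (@scaleP F) (fun x => (fpoly q a b c d).[x])
      (cubic_map c0 c1 c2 c3).
Proof.
have q_gt1 : (1 < q)%N := card_finNzRing_gt1 F.
have [theta theta_prim] := finField_prim_root L.
have theta_nfix : theta ^+ q != theta.
  rewrite -[X in _ != X]expr1 (eq_prim_root_expr theta_prim) !modn_small ?gtn_eqF //; first by nia.
  by rewrite cardL; nia.
have e_bij := pair_ext_bij theta_nfix.
have [e' _ e'K] := e_bij; set e := pair_ext theta in e_bij e'K; set phi := theta ^+ q.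
(* These are the coefficients of f (x + y theta), as (x + y theta) ^ q = x + y phi. *)
pose c0 := e' (a + b + c + d).
pose c1 := e' (3%:R * a * phi + b * (2%:R * phi + theta)
             + c * (phi + 2%:R * theta) + 3%:R * d * theta).
pose c2 := e' (3%:R * a * phi ^+ 2 + b * (phi ^+ 2 + 2%:R * phi * theta)
             + c * (2%:R * phi * theta + theta ^+ 2) + 3%:R * d * theta ^+ 2).
pose c3 := e' (a * phi ^+ 3 + b * phi ^+ 2 * theta + c * phi * theta ^+ 2 + d * theta ^+ 3).
exists c0, c1, c2, c3, e, e.
split; [exact: pair_ext_Flinear | by [] | exact: pair_ext_Flinear | by [] |].
move=> v; rewrite horner_fpoly pair_ext_expf_card -/phi.
transitivity (e c0 * iota v.1 ^+ 3 + e c1 * (iota v.1 ^+ 2 * iota v.2)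
   + e c2 * (iota v.1 * iota v.2 ^+ 2) + e c3 * iota v.2 ^+ 3).
  by rewrite !e'K /e /pair_ext; ring.
by rewrite /e /pair_ext /cubic_map /binary_cubic /= !(rmorphD, rmorphM iota) /=; ring.
Qed.

End QuadraticExtensionCoordinates.

Section PoleFormModels.
Variables (F L : finFieldType) (iota : {rmorphism F -> L}).
Hypothesis cardL : #|L| = (#|F| ^ 2)%N.
Local Notation q := #|F|.
Variables t m : F.
Hypothesis tm_anis : anisotropic t m.

(* (x, y) |-> x - nu y identifies F * F with L and quad_form t m with the norm of L. *)
Lemma pole_form0_equiv_expf :
  lin_equiv (@scaleP F) (scaleL iota) (pole_form t m 0 0) (fun x : L => x ^+ (q + 2)).
Proof.
have [nu [nu_nfix tE mE]] := anisotropic_conj_roots iota cardL tm_anis.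
have e_bij : bijective (pair_ext iota (- nu)).
  by apply: pair_ext_bij => //; rewrite (exprN_card iota) eqr_opp.
apply: lin_equiv_sym; exists (pair_ext iota (- nu)), (pair_ext iota (- nu)).
split; [exact: pair_ext_Flinear | by [] | exact: pair_ext_Flinear | by [] |].
move=> v; rewrite exprD pair_ext_expf_card (exprN_card iota) /pair_ext /pole_form /quad_form /=.
by rewrite !(rmorphD, rmorphN, rmorphM, rmorph0) /= tE mE; ring.
Qed.

(* If w is a primitive cube root of unity and nu, mu are the conjugate roots of X ^ 2 - t X + m,
   then the Lagrange resolvent w nu + w ^ 2 mu lies in F. *)
Lemma exists_resolvent_root : (q %% 3 = 2)%N ->
  exists k : F, resolvent t m k = 0.
Proof.
move=> q_mod3; have [nu [_ tE mE]] := anisotropic_conj_roots iota cardL tm_anis.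
have muK := expf_cardK cardL nu; set mu := nu ^+ q in tE mE muK.
have q_gt1 : (1 < q)%N := card_finNzRing_gt1 F.
have [|w w_prim] := @finField_prim_root_dvd L 3.
  by rewrite cardL (divn_eq q 3) q_mod3; nia.
have w_sum : w ^+ 2 = - 1 - w.
  have := sum_prim_root _ w_prim; rewrite !big_ord_recl big_ord0 /= => /(_ isT) w_sum.
  by rewrite -[RHS]addr0 -w_sum; ring.
have wq : w ^+ q = w ^+ 2 by rewrite -(prim_expr_mod w_prim) q_mod3.
have w4 : (w ^+ 2) ^+ 2 = w by rewrite -exprM -(prim_expr_mod w_prim).
have /(expf_card_fixedP iota)[k kE] : (w * nu + w ^+ 2 * mu) ^+ q == w * nu + w ^+ 2 * mu.
  by rewrite (exprD_card iota) (exprMn _ w nu) (exprMn _ (w ^+ 2) mu) muK exprAC wq w4 addrC.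
exists k; apply: (fmorph_inj iota); rewrite rmorph0.
rewrite /resolvent !rmorphD rmorphN !rmorphXn !rmorphM rmorph_nat -kE tE mE /=.
by ring: w_sum.
Qed.

(* The roots of the resolvent are k and - t - k, and the square of their difference is
   - 3 disc t m. *)
Lemma exceptional_form_equiv_cubes : (q %% 3 = 2)%N ->
  lin_equiv (@scaleP F) (@scaleP F) (exceptional_form t m) (@cubes F).
Proof.
move=> q_mod3; have [k k_root] := exists_resolvent_root q_mod3.
have three_neq0 : 3%:R != 0 :> F by rewrite natr_prime_eq0 // /dvdn q_mod3.
have diff_neq0 : - t - k - k != 0.
  apply: contra_neq (mulf_neq0 three_neq0 (disc_neq0 iota cardL tm_anis)) => diff0.
  transitivity (4%:R * resolvent t m k - (- t - k - k) ^+ 2).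
    by rewrite /resolvent /disc; ring.
  by rewrite k_root diff0; ring.
have k'_root : resolvent t m (- t - k) = 0 by rewrite -[RHS]k_root /resolvent; ring.
apply: lin_equiv_sym.
apply: (@lin_equiv_lin2 _ _ _ 1 (3%:R * k + t) 1 (3%:R * (- t - k) + t) 1 k 1 (- t - k)).
- rewrite (_ : _ - _ = 3%:R * (- t - k - k)); last by ring.
  by rewrite mulf_neq0.
- by rewrite mul1r mulr1.
- by move=> v; rewrite /lin2 /cubes /= !mul1r !exceptional_form_cube.
Qed.

(* In characteristic 3 the resolvent is (k - t) ^ 2, so that only one cube of a linear form is
   left in the pencil. *)
Lemma exceptional_form_equiv_additive_cubic : (q %% 3 == 0)%N ->
  exists e : F, [/\ e != 0, ~ (exists y : F, y ^+ 2 = e) &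
    lin_equiv (@scaleP F) (@scaleP F) (exceptional_form t m) (additive_cubic e)].
Proof.
rewrite -[(_ == _)]/(3 %| q)%N -natr_prime_eq0 // => /eqP three_eq0.
have D_neq0 := disc_neq0 iota cardL tm_anis; exists (disc t m); split=> //.
  apply: (disc_nonsquare _ tm_anis); have -> : 2%:R = 3%:R - 1 :> F by ring.
  by rewrite three_eq0 sub0r oppr_eq0 oner_neq0.
set D := disc t m in D_neq0 *.
apply: lin_equiv_sym; apply: (@lin_equiv_lin2 _ _ _ 0 (- D ^+ 2) 1 t 0 D 1 t).
- by rewrite mul0r sub0r mulr1 opprK expf_neq0.
- by rewrite mul0r sub0r mulr1 oppr_eq0.
move=> v; rewrite /additive_cubic /lin2 /=; congr (_, _).
  transitivity (- D ^+ 2 * (exceptional_form t m v).2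
    - 3%:R * D ^+ 2 * (t * v.1 * v.2 ^+ 2 + m * v.2 ^+ 3)); last by rewrite three_eq0 /=; ring.
  by rewrite /exceptional_form /pole_form /quad_form /D /disc /=; ring.
have t_root : resolvent t m t = 0.
  by transitivity (3%:R * (t ^+ 2 - m)); [rewrite /resolvent; ring | rewrite three_eq0 mul0r].
by rewrite !mul1r -(exceptional_form_cube v t_root) three_eq0 mul0r add0r.
Qed.

End PoleFormModels.

Section BijectiveModels.
Variable F : finFieldType.
Local Notation q := #|F|.

Lemma expf_addn2_bij (L : finFieldType) : #|L| = (q ^ 2)%N -> (q %% 3 != 1)%N ->
  bijective (fun x : L => x ^+ (q + 2)).
Proof.
move=> cardL q_mod3; apply/injF_bij/expf_coprime_inj; first by rewrite addn2.
have q_gt1 : (1 < q)%N := card_finNzRing_gt1 F.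
have predLE : (#|L|.-1 = (q - 2) * (q + 2) + 3)%N by rewrite cardL; nia.
by rewrite predLE /coprime gcdnMDl -/(coprime _ 3) coprime_sym prime_coprime //; lia.
Qed.

Lemma cubes_bij : (q %% 3 != 1)%N -> bijective (@cubes F).
Proof.
move=> q_mod3; apply: injF_bij => -[x y] [z w] [xz yw].
by rewrite (expf3_inj q_mod3 xz) (expf3_inj q_mod3 yw).
Qed.

Lemma additive_cubic_bij (e : F) : (q %% 3 == 0)%N -> ~ (exists y : F, y ^+ 2 = e) ->
  bijective (additive_cubic e).
Proof.
move=> q_mod3 e_nonsq; have three_eq0 : 3%:R = 0 :> F by apply/eqP; rewrite natr_prime_eq0.
apply: injF_bij => -[x y] [z w] [xz /expf3_inj]; rewrite /= (eqP q_mod3) => /(_ isT) yw.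
subst w; congr (_, _); apply/eqP; rewrite -subr_eq0; apply: contraT => xz_neq0.
have /eqP : (x - z) * ((x - z) ^+ 2 - e * y ^+ 2) = 0.
  transitivity ((x ^+ 3 - e * x * y ^+ 2) - (z ^+ 3 - e * z * y ^+ 2)
    + 3%:R * (x * z ^+ 2 - x ^+ 2 * z)); first by ring.
  by rewrite three_eq0 xz subrr mul0r addr0.
rewrite mulf_eq0 (negPf xz_neq0) subr_eq0 => /eqP sqE.
have y_neq0 : y != 0.
  by apply: contraNneq xz_neq0 => y0; rewrite -sqrf_eq0 sqE y0 expr0n mulr0.
by case: e_nonsq; exists ((x - z) / y); rewrite expr_div_n sqE mulfK // expf_neq0.
Qed.

End BijectiveModels.

Theorem theorem1p10 (F L : finFieldType) (iota : {rmorphism F -> L})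
  (hL : #|L| = (#|F| ^ 2)%N) (a b c d : L) :
  let q := #|F| in
  let f := fun x : L => (fpoly q a b c d).[x] in
  bijective f <->
  [\/ ((q %% 3 != 1)%N /\
        lin_equiv (scaleL iota) (scaleL iota) f (fun x : L => x ^+ (q + 2))),
      ((q %% 3 != 1)%N /\
        lin_equiv (scaleL iota) (@scaleP F) f
          (fun v : F * F => (v.1 ^+ 3, v.2 ^+ 3)))
    | ((q %% 3 == 0)%N /\
        exists e : F, [/\ e != 0, ~ (exists y : F, y ^+ 2 = e) &
          lin_equiv (scaleL iota) (@scaleP F) f
            (fun v : F * F => (v.1 ^+ 3 - e * v.1 * v.2 ^+ 2, v.2 ^+ 3))])].
Proof.
move=> q f; split=> [f_bij|]; last first.
  case=> [[q_mod3 E]|[q_mod3 E]|[q_mod3 [e [_ e_nonsq E]]]]; apply: (lin_equiv_bij E).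
  - exact: expf_addn2_bij.
  - exact: cubes_bij.
  - exact: additive_cubic_bij.
have [c0 [c1 [c2 [c3 fG]]]] := fpoly_equiv_cubic_map iota hL a b c d.
have G_bij := lin_equiv_bij (lin_equiv_sym fG) f_bij.
have q_mod3 := bij_cubic_map_card_mod3 G_bij.
have [GE|[t [m [r [s [tm_anis GE]]]]]] := bij_cubic_map_normal_form q_mod3 G_bij.
  by apply: Or32; split=> //; exact: lin_equiv_trans fG GE.
have {GE}fN := lin_equiv_trans fG GE.
have /bij_inj/(inj_pole_form_pole_fun q_mod3 tm_anis) := lin_equiv_bij (lin_equiv_sym fN) f_bij.
case/(inj_pole_fun iota hL tm_anis) => -[rE sE]; subst r s.
  by apply: Or31; split=> //; exact: lin_equiv_trans fN (pole_form0_equiv_expf iota hL tm_anis).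
have [three_dvd|three_ndvd] := boolP (q %% 3 == 0)%N; last first.
  apply: Or32; split=> //; apply: lin_equiv_trans fN _.
  by apply: (exceptional_form_equiv_cubes iota hL tm_anis); rewrite -/q; lia.
apply: Or33; split=> //; have [e [e_neq0 e_nonsq eE]] :=
  exceptional_form_equiv_additive_cubic iota hL tm_anis three_dvd.
by exists e; split=> //; exact: lin_equiv_trans fN eE.
Qed.
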